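(* Let $n$ be an even positive integer with $n=2^{\alpha_1}d$, where $\alpha_1\geq 1$ and $d$ is odd, and assume $d>1$. Then the graph $(K_d\otimes K^*_{n/d})\otimes (K_d\otimes K^*_{n/d})$ (on $n^2$ vertices) is not a circulant graph.
   Context: $K_r$ denotes the complete graph on $r$ vertices (no loops), and $K^*_r$ denotes the complete graph on $r$ vertices with a loop attached at every vertex (adjacency matrix the all-ones matrix). The tensor product $G\otimes H$ of graphs $G$ and $H$ has vertex set $V(G)\times V(H)$, with $(u,u')$ adjacent to $(v,v')$ if and only if $u$ is adjacent to $v$ in $G$ and $u'$ is adjacent to $v'$ in $H$ (adjacency including loops). A graph is circulant if it is isomorphic to a circulant graph $G(N;S)$, i.e. a graph on $\mathbb{Z}_N$ where $i\sim j$ iff $i-j\equiv s\pmod N$ for some $s\in S$, with $S\subseteq\{1,\ldots,N-1\}$, $S=N-S$. *)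

(* Defs.v *)
From HB Require Import structures.
From mathcomp Require Import all_boot all_order all_algebra.
From mathcomp Require Import zify.

Set Implicit Arguments.
Unset Strict Implicit.
Unset Printing Implicit Defensive.

Import GRing.Theory.

(* Finite undirected graphs; loops are allowed, multiple edges are not. *)
Record graph := Graph {
  vertex : finType;
  adj : rel vertex;
  adj_sym : symmetric adj
}.

Definition graph_iso (G H : graph) : Prop :=
  exists2 f : vertex G -> vertex H,
    bijective f & forall u v, adj (f u) (f v) = adj u v.

Lemma complete_sym (r : nat) : symmetric (fun u v : 'I_r => u != v).
Proof. by move=> u v; rewrite eq_sym. Qed.

Definition complete_graph (r : nat) : graph := Graph (@complete_sym r).

Lemma looped_complete_sym (r : nat) : symmetric (fun _ _ : 'I_r => true).
Proof. by []. Qed.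

Definition looped_complete_graph (r : nat) : graph :=
  Graph (@looped_complete_sym r).

Lemma tensor_sym (G H : graph) :
  symmetric (fun u v : vertex G * vertex H => adj u.1 v.1 && adj u.2 v.2).
Proof. by move=> u v; rewrite adj_sym [X in _ && X]adj_sym. Qed.

Definition tensor (G H : graph) : graph := Graph (@tensor_sym G H).

(* The finite set S is listed by a sequence; only membership in it matters. *)
Definition connection_set (N : nat) (S : seq nat) : Prop :=
  {subset S <= iota 1 N.-1} /\ [seq N - s | s <- S] =i S.

(* The ring Z_N is represented by its residues 'I_N, since 'Z_N is not the
   integers mod N when N <= 1. *)
Definition circulant_adj (N : nat) (S : seq nat) : rel 'I_N :=
  fun i j => has (fun s : nat => ((i%:Z - j%:Z)%R == s%:Z %[mod N%:Z])%Z) S.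

Lemma circulant_sym (N : nat) (S : seq nat) :
  connection_set N S -> symmetric (@circulant_adj N S).
Proof.
case=> subS oppS.
suff imp i j : @circulant_adj N S i j -> @circulant_adj N S j i.
  by move=> i j; apply/idP/idP; apply: imp.
case/hasP=> s Ss Es; apply/hasP; exists (N - s).
  by rewrite -oppS; apply/mapP; exists s.
have leN : s <= N.
  by move: (subS s Ss); rewrite mem_iota; case: (N) => [|m] /andP[]; lia.
move: Es; rewrite !eqz_mod_dvd => Es.
have -> : (j%:Z - i%:Z - (N - s)%N%:Z = - (i%:Z - j%:Z - s%:Z + N%:Z))%R by lia.
by rewrite dvdzE abszN -dvdzE rpredD.
Qed.

Definition circulant_graph (N : nat) (S : seq nat) (hS : connection_set N S) :
  graph := Graph (circulant_sym hS).

Definition is_circulant (G : graph) : Prop :=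
  exists (N : nat) (S : seq nat) (hS : connection_set N S),
    0 < N /\ graph_iso G (circulant_graph hS).

(* Main.v *)
(** Write a vertex as x, with a x and b x its two [K_d]-coordinates: x and y
    are adjacent iff they differ in both, so the graph is the blow-up of the
    complement of a rook's graph.  If the graph is circulant, the cyclic group
    Z_N acts on it regularly by translations.  An automorphism of a rook's graph
    either maps rows to rows or maps rows to columns and columns to rows.  The
    translations fixing every cell (a, b) form a subgroup of odd index d^2, so every
    translation is the product of one of them by a square, hence maps rows to
    rows.  The row and the column through the identity are then subgroups of
    the same order in a cyclic group, so they coincide, which is absurd. *)

Require Import Defs.
From mathcomp Require Import all_boot all_order all_algebra.
From mathcomp Require Import all_fingroup all_solvable.
From mathcomp Require Import zify.

Set Implicit Arguments.
Unset Strict Implicit.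
Unset Printing Implicit Defensive.

Section Translations.

Import GroupScope.

Lemma expg_index (gT : finGroupType) (G H : {group gT}) x :
  H <| G -> x \in G -> x ^+ #|G : H| \in H.
Proof.
case/andP=> sHG nHG Gx; have Nx := subsetP nHG x Gx.
rewrite coset_idr ?groupX // morphX // -card_quotient //.
by apply/eqP; rewrite -order_dvdn order_dvdG // mem_quotient.
Qed.

(** Yields the subgroups formed by the cell, the row and the column of the identity. *)
Lemma fiber_group_set (gT : finGroupType) (I : eqType) (c : gT -> I) :
  (forall x y t, c x = c y -> c (x * t) = c (y * t)) ->
  group_set [set t | c t == c 1].
Proof.
move=> cM; apply/group_setP; split=> [|x y]; rewrite !inE //.
by move=> /eqP cx /eqP <-; rewrite (cM _ _ y cx) mul1g.
Qed.

Lemma card_fiber (T I J : finType) (a : T -> I) (b : T -> J) m i :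
  (forall j, #|[set x | (a x == i) && (b x == j)]| = m) ->
  #|[set x | a x == i]| = (#|J| * m)%N.
Proof.
move=> card_ab; rewrite -sum1_card (partition_big b xpredT) //=.
rewrite (eq_bigr (fun=> m)) ?sum_nat_const // => j _.
by rewrite -(card_ab j) -sum1_card; apply: eq_bigl => x; rewrite !inE.
Qed.

Lemma exists_ord_neq2 d (i j : 'I_d) :
  2 < d -> exists2 k : 'I_d, k != i & k != j.
Proof.
move=> d_gt2; have /card_gt0P[k]: 0 < #|~: [set i; j]|.
  by rewrite cardsCs setCK card_ord cards2; lia.
by rewrite !inE negb_or => /andP[]; exists k.
Qed.

(** The rook's graph with loops, pulled back to [T] along [(a, b)]; it will be the complement of
    adjacency in the tensor product. *)
Definition same_line (T : Type) (I J : eqType) (a : T -> I) (b : T -> J) x y :=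
  (a x == a y) || (b x == b y).

Lemma same_lineC (T : Type) (I J : eqType) (a : T -> I) (b : T -> J) x y :
  same_line b a x y = same_line a b x y.
Proof. exact: orbC. Qed.

(** Points of a row have collinear images. If two of these lie in different rows, they share a
    column, which then contains the image of the whole row; comparison with this row sends each
    other row into one column too. *)
Lemma line_map_rows (T : finType) (I J : eqType) (a : T -> I) (b : T -> J)
    (s : T -> T) :
  (forall i j, exists2 x, a x = i & b x = j) ->
  (forall x y, same_line a b (s x) (s y) = same_line a b x y) ->
  (forall x y, a x = a y -> b x = b y -> b (s x) = b (s y)) ->
  (forall x y, a x = a y -> a (s x) = a (s y)) \/
  (forall x y, a x = a y -> b (s x) = b (s y)).
Proof.
move=> ab_surj s_line s_cell.
have lineE x y : a x = a y -> a (s x) = a (s y) \/ b (s x) = b (s y).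
  move=> axy; have: same_line a b (s x) (s y).
    by rewrite s_line /same_line axy eqxx.
  by case/orP=> /eqP; [left | right].
have [s_rows|] := boolP
    [forall x, forall y, (a x == a y) ==> (a (s x) == a (s y))].
  left=> x y axy; move/forallP/(_ x)/forallP/(_ y): s_rows.
  by rewrite axy eqxx => /eqP.
case/forallPn=> x0 /forallPn[y0]; rewrite negb_imply.
case/andP=> /eqP axy0 /eqP asxy0.
have bsxy0: b (s x0) = b (s y0) by case: (lineE _ _ axy0).
have s_row0 z : a z = a x0 -> b (s z) = b (s x0).
  move=> azx; case: (lineE _ _ azx) => // asz.
  case: (lineE z y0) => [|asz'|->//]; first by rewrite azx.
  by case: asxy0; rewrite -asz.
right=> x y axy; have [ax0 | ax0] := eqVneq (a x) (a x0).
  by rewrite !s_row0 -?axy.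
apply/eqP; apply: contraT => bsxy.
have asxy: a (s x) = a (s y).
  by case: (lineE _ _ axy) => // bs; rewrite bs eqxx in bsxy.
have bxy: b x != b y by apply: contraNneq bsxy => /(s_cell _ _ axy)->.
(* The point of row x0 in the column of u, being off the line through u and v,
   is mapped to the column of u; all of row x0 is mapped to a single column. *)
have bs_row0 u v : a u = a v -> a u != a x0 -> b u != b v ->
    a (s u) = a (s v) -> b (s u) = b (s x0).
  move=> auv au buv asuv; have [u' au' bu'] := ab_surj (a x0) (b u).
  have: same_line a b (s u') (s u) by rewrite s_line /same_line bu' eqxx orbT.
  have: ~~ same_line a b (s u') (s v).
    by rewrite s_line negb_or au' bu' -auv eq_sym au.
  rewrite negb_or -asuv => /andP[/negPf asu _].
  by rewrite /same_line asu => /eqP <-; apply: s_row0.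
by case/eqP: bsxy; rewrite (bs_row0 x y) // (bs_row0 y x) // -?axy // eq_sym.
Qed.

Lemma line_map_square_rows (T : finType) (I J : eqType) (a : T -> I)
    (b : T -> J) (s : T -> T) :
  (exists i j : I, i != j) -> (exists i j : J, i != j) ->
  (forall i j, exists2 x, a x = i & b x = j) ->
  (forall x y, same_line a b (s x) (s y) = same_line a b x y) ->
  (forall x y, a x = a y -> b x = b y ->
    a (s x) = a (s y) /\ b (s x) = b (s y)) ->
  forall x y, a x = a y -> a (s (s x)) = a (s (s y)).
Proof.
move=> [i1 [i2 i12]] [j1 [j2 j12]] ab_surj s_line s_cell.
have s_cell_b x y : a x = a y -> b x = b y -> b (s x) = b (s y).
  by move=> axy /(s_cell _ _ axy)[].
have [s_rows | rows_cols] := line_map_rows ab_surj s_line s_cell_b.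
  by move=> x y axy; apply/s_rows/s_rows.
have ba_surj j i : exists2 x, b x = j & a x = i.
  by have [x] := ab_surj i j; exists x.
have s_line_ba x y : same_line b a (s x) (s y) = same_line b a x y.
  by rewrite !(same_lineC a b).
have s_cell_a x y : b x = b y -> a x = a y -> a (s x) = a (s y).
  by move=> bxy /s_cell/(_ bxy)[].
have [cols_cols | cols_rows] := line_map_rows ba_surj s_line_ba s_cell_a.
  (* Rows and columns cannot both go to columns: via the corner [z], the non-collinear points [x]
     and [y] would get images in one column. *)
  have [x ax bx] := ab_surj i1 j1; have [y ay by_] := ab_surj i2 j2.
  have [z az bz] := ab_surj i1 j2.
  have: same_line a b (s x) (s y).
    rewrite /same_line (rows_cols x z) ?ax // (cols_cols z y) ?bz //.
    by rewrite eqxx orbT.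
  by rewrite s_line /same_line ax ay bx by_ (negPf i12) (negPf j12).
by move=> x y axy; apply/cols_rows/rows_cols.
Qed.

(** A point in the row of [x] that avoids the columns of [x] and [y] is collinear with [y] only if
    their rows agree; [2 < d] provides such a column. Hence translations that preserve lines
    preserve cells. *)
Lemma same_cellP (T : Type) (d : nat) (a b : T -> 'I_d) x y :
  2 < d -> (forall i j, exists2 z, a z = i & b z = j) ->
  (forall z, same_line a b x z = same_line a b y z) <-> a x = a y /\ b x = b y.
Proof.
move=> d_gt2 ab_surj; split=> [Exy | [axy bxy] z]; last first.
  by rewrite /same_line axy bxy.
split; apply/eqP.
- have [k kx ky] := exists_ord_neq2 (b x) (b y) d_gt2.
  have [z az bz] := ab_surj (a x) k.
  have := Exy z; rewrite /same_line az bz eqxx (eq_sym (b y)) (negPf ky) orbF.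
  by rewrite (eq_sym (a x)) => <-.
- have [k kx ky] := exists_ord_neq2 (a x) (a y) d_gt2.
  have [z az bz] := ab_surj k (b x).
  have := Exy z; rewrite /same_line az bz eqxx orbT (eq_sym (a y)) (negPf ky).
  by rewrite (eq_sym (b x)) => /= <-.
Qed.

Lemma line_invariant_rows (gT : finGroupType) (d m : nat) (a b : gT -> 'I_d) :
  abelian [set: gT] -> 2 < d -> odd d -> 0 < m ->
  (forall i j, #|[set x | (a x == i) && (b x == j)]| = m) ->
  (forall x y t, same_line a b (x * t) (y * t) = same_line a b x y) ->
  forall x y t, a x = a y -> a (x * t) = a (y * t).
Proof.
move=> abG d_gt2 d_odd m_gt0 card_ab ab_line.
have ab_surj i j : exists2 x, a x = i & b x = j.
  have /card_gt0P[x]: 0 < #|[set x | (a x == i) && (b x == j)]|.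
    by rewrite card_ab.
  by rewrite inE => /andP[/eqP ax /eqP bx]; exists x.
have ab_cell x y t : a x = a y -> b x = b y ->
    a (x * t) = a (y * t) /\ b (x * t) = b (y * t).
  move=> axy bxy; apply/(same_cellP _ _ d_gt2 ab_surj) => z.
  (* Every point is a translate by [t], so collinearity with [x * t] and [y * t] reduces to that
     with [x] and [y]. *)
  rewrite -(mulgKV t z) !ab_line.
  by move: (z * t^-1); apply/(same_cellP x y d_gt2 ab_surj).
pose c x := (a x, b x).
have cM x y t : c x = c y -> c (x * t) = c (y * t).
  by case=> axy bxy; rewrite /c; case: (ab_cell x y t axy bxy) => -> ->.
pose H := Group (fiber_group_set cM).
have oH : #|H| = m.
  by rewrite -(card_ab (a 1) (b 1)); apply: eq_card => x; rewrite !inE.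
have oG : #|[set: gT]| = (d ^ 2 * m)%N.
  have sum_a : \sum_i #|[set x | a x == i]| = #|[set: gT]|.
    rewrite cardsT -sum1_card (partition_big a xpredT) //=.
    by apply: eq_bigr => i _; rewrite -sum1_card; apply: eq_bigl => x;
      rewrite inE.
  rewrite -sum_a (eq_bigr (fun=> d * m)%N) => [|i _].
    by rewrite sum_nat_const card_ord; lia.
  by rewrite (card_fiber (card_ab i)) card_ord.
have iH : #|[set: gT] : H| = (d ^ 2)%N.
  by rewrite -divgS ?subsetT // oG oH mulnK.
have nHG : H <| [set: gT] by rewrite -sub_abelian_normal ?subsetT.
have ord_neq : exists i j : 'I_d, i != j.
  have d_gt0 : 0 < d by lia.
  have [k k0 _] := exists_ord_neq2 (Ordinal d_gt0) (Ordinal d_gt0) d_gt2.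
  by exists k, (Ordinal d_gt0).
have sq_rows t x y : a x = a y -> a (x * t * t) = a (y * t * t).
  apply: (@line_map_square_rows _ _ _ a b (fun z => z * t)) => // x' y'.
  exact: ab_cell.
move=> x y t axy; pose k := (d ^ 2)./2.
have Ht : t ^+ (d ^ 2) \in H by rewrite -iH expg_index ?inE.
(* By commutativity [z * h] is the translate by [z] of [h], which lies in the cell of [1]. *)
have xh_rows h z : h \in H -> a (z * h) = a z.
  rewrite inE (centsP abG z _ h) ?inE // => /eqP[ah bh].
  by have [] := ab_cell h 1 z ah bh; rewrite mul1g.
(* Since [d ^ 2 = 2 * k + 1], [t] is the square of [t ^- k] times an element of [H]. *)
have -> : t = t ^- k * t ^- k * t ^+ (d ^ 2).
  rewrite -invMg -expgD addnn -(odd_double_half (d ^ 2)) oddX d_odd -/k.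
  by rewrite addnC expgD mulKg.
by rewrite !mulgA !(xh_rows (t ^+ _)) //; apply: sq_rows.
Qed.

Lemma cyclic_not_line_invariant (gT : finGroupType) (d m : nat)
    (a b : gT -> 'I_d) :
  cyclic [set: gT] -> 2 < d -> odd d -> 0 < m ->
  (forall i j, #|[set x | (a x == i) && (b x == j)]| = m) ->
  ~ (forall x y t, same_line a b (x * t) (y * t) = same_line a b x y).
Proof.
move=> cycG d_gt2 d_odd m_gt0 card_ab ab_line.
have card_ba i j : #|[set x | (b x == i) && (a x == j)]| = m.
  by rewrite -(card_ab j i); apply: eq_card => x; rewrite !inE andbC.
have ba_line x y t : same_line b a (x * t) (y * t) = same_line b a x y.
  by rewrite !(same_lineC a b).
have abG := cyclic_abelian cycG.
have aM := line_invariant_rows abG d_gt2 d_odd m_gt0 card_ab ab_line.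
have bM := line_invariant_rows abG d_gt2 d_odd m_gt0 card_ba ba_line.
pose A := Group (fiber_group_set aM); pose B := Group (fiber_group_set bM).
(* Both have order [d * m], and a cyclic group has at most one subgroup of each order. *)
have /eqP/= eqAB : A :==: B.
  rewrite (eq_subG_cyclic cycG) ?subsetT //=.
  by rewrite (card_fiber (card_ab _)) (card_fiber (card_ba _)).
have [k k1 _] := exists_ord_neq2 (b 1) (b 1) d_gt2.
have /card_gt0P[x]: 0 < #|[set x | (a x == a 1) && (b x == k)]|.
  by rewrite card_ab.
rewrite inE => /andP[ax /eqP bx]; move/setP/(_ x): eqAB.
by rewrite !inE ax bx (negPf k1).
Qed.

(** The product in ['I_N.+1] is addition modulo [N.+1], so translation preserves differences; [p]
    and [q] count the wraparounds. *)
Lemma circulant_adjM N (S : seq nat) (x y t : 'I_N.+1) :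
  @circulant_adj N.+1 S (x * t) (y * t) = circulant_adj S x y.
Proof.
apply: eq_has => s; rewrite !eqz_mod_dvd.
have val_mulg (z : 'I_N.+1) : exists q : nat, ((z * t)%g + q * N.+1 = z + t)%N.
  by exists ((z + t) %/ N.+1)%N; rewrite addnC -divn_eq.
have [p Ep] := val_mulg x; have [q Eq] := val_mulg y.
have -> : ((x * t)%g%:Z - (y * t)%g%:Z - s%:Z =
    x%:Z - y%:Z - s%:Z + (q%:Z - p%:Z) * N.+1%:Z)%R by lia.
by rewrite GRing.rpredDr // dvdz_mull.
Qed.

End Translations.

Theorem theorem4p2 (n alpha1 d : nat) (n_pos : 0 < n) (n_even : ~~ odd n)
    (n_def : n = 2 ^ alpha1 * d) (alpha1_ge1 : 1 <= alpha1)
    (d_odd : odd d) (d_gt1 : 1 < d) :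
  ~ is_circulant
      (tensor (tensor (complete_graph d) (looped_complete_graph (n %/ d)))
              (tensor (complete_graph d) (looped_complete_graph (n %/ d)))).
Proof.
case=> [[|N]] [S [hS [//= _ [f [g fK gK] f_adj]]]].
have d_gt2 : 2 < d by case: d d_odd d_gt1 {n_def f g fK gK f_adj} => [|[|[]]].
pose k := n %/ d; have k_gt0 : 0 < k.
  by rewrite /k n_def mulnK ?expn_gt0 //; lia.
pose a x := (g x).1.1; pose b x := (g x).2.1.
apply: (@cyclic_not_line_invariant 'I_N.+1 d (k ^ 2)%N a b) => // [|||x y t].
- by rewrite Zp_cycle cycle_cyclic.
- by rewrite expn_gt0 k_gt0.
- move=> i j.
  (* A cell fixes both [K_d] coordinates and leaves the two looped ones free, hence [k ^ 2]
     vertices. *)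
  have -> : [set x | (a x == i) && (b x == j)] =
      f @: setX (setX [set i] setT) (setX [set j] setT).
    apply/setP=> x; rewrite -[x]gK mem_imset; last exact: can_inj fK.
    by rewrite !inE /a /b fK !andbT.
  rewrite card_imset; last exact: can_inj fK.
  by rewrite !cardsX !cards1 !cardsT !card_ord !mul1n mulnn.
(* Looped factors never obstruct adjacency, so non-adjacency means agreement in some [K_d]
   coordinate. *)
- have lineE u v : same_line a b u v = ~~ circulant_adj S u v.
    have := f_adj (g u) (g v); rewrite !gK /= => ->.
    by rewrite !andbT negb_and !negbK.
  by rewrite !lineE circulant_adjM.
Qed.
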